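(* Let $G$ be a finite simple graph with vertex set $V$. Then $G$ carries a function if and only if for every subset $U\subseteq V$, the total number of edges of $G$ that are incident to at least one vertex in $U$ is at least $\lvert U\rvert$.
   Context: A simple graph $G$ on a set $V$ of vertices is a symmetric irreflexive binary relation on $V$ (adjacency). An edge of $G$ is an unordered pair of adjacent vertices, and the vertices comprising an edge are said to be incident to it. The graph is finite if $V$ is finite. A graph $G$ with vertex set $V$ carries a function $f:V\to V$ if (1) $v$ is adjacent to $f(v)$ for all $v\in V$, and (2) $f(f(v))\neq v$ for all $v\in V$ (that is, if the edges $\{v,f(v)\}$ and $\{w,f(w)\}$ are equal as unordered pairs, then $v=w$). ''$G$ carries a function'' means that there exists a function $f:V\to V$ carried by $G$. *)

(* Defs.v *)
From mathcomp Require Import all_boot.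

Set Implicit Arguments.
Unset Strict Implicit.
Unset Printing Implicit Defensive.

Definition carries (V : Type) (adj : rel V) (f : V -> V) : Prop :=
  (forall v : V, adj v (f v)) /\ (forall v : V, f (f v) <> v).

Definition carries_function (V : Type) (adj : rel V) : Prop :=
  exists f : V -> V, carries adj f.

(* Edges are unordered pairs, encoded as the two-element sets [set v; w]. *)
Definition edges (V : finType) (adj : rel V) : {set {set V}} :=
  [set [set v; w] | v in V, w in V & adj v w].

Definition incident_edges (V : finType) (adj : rel V) (U : {set V}) :
    {set {set V}} :=
  [set E in edges adj | [exists u in U, u \in E]].

(* Main.v *)
Require Import Defs.
From mathcomp Require Import all_boot.

(** A function carried by the graph is the same thing as an injective choice,
    for every vertex, of an edge incident to it: [v |-> {v, f v}] is injective
    exactly because [f (f v) <> v], and conversely the other end of the edge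
    chosen at [v] may serve as [f v].  Since the edges incident to [U] form the
    union of the sets of edges at the vertices of [U], the counting condition is
    Hall's condition for the family of these sets, and the theorem is Hall's
    marriage theorem [hall_marriage] for that family.

    Hall's theorem is proved by Rado's argument.  As long as some member of the
    family has two distinct elements, one of the two can be deleted without
    destroying Hall's condition ([hall_delete]); once all members have at most
    one element, Hall's condition for singletons and pairs says that they are
    pairwise distinct singletons ([hall_small]). *)

Definition hall_condition {I T : finType} (N : I -> {set T}) : bool :=
  [forall U : {set I}, #|U| <= #|\bigcup_(i in U) N i|].

Definition delete {I T : finType} (N : I -> {set T}) (a : I) (x : T)
    (i : I) : {set T} :=
  if i == a then N a :\ x else N i.

Lemma delete_sub {I T : finType} (N : I -> {set T}) a x i :
  delete N a x i \subset N i.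
Proof. by rewrite /delete; case: eqP => [->|//]; apply: subD1set. Qed.

(** A violation of Hall's condition after a deletion at [a] must occur at a set
    containing [a]; removing [a] from that set isolates the contribution of
    [N a :\ x], and turns the strict inequality into a non-strict one. *)
Lemma delete_violation {I T : finType} (N : I -> {set T}) a x :
    hall_condition N -> ~~ hall_condition (delete N a x) ->
  exists2 W : {set I}, a \notin W &
    #|(N a :\ x) :|: \bigcup_(i in W) N i| <= #|W|.
Proof.
move=> /forallP hallN /forallPn [U]; rewrite -ltnNge => ltU.
have eq_out (W : {set I}) :
    a \notin W -> \bigcup_(i in W) delete N a x i = \bigcup_(i in W) N i.
  move=> aNW; apply: eq_bigr => i iW; rewrite /delete.
  by case: eqP => // ia; rewrite -ia iW in aNW.
have aU : a \in U.
  apply: contraLR ltU => aNU; rewrite -leqNgt eq_out //; exact: hallN.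
exists (U :\ a); first by rewrite setD11.
move: ltU; rewrite (cardsD1 a U) aU ltnS (big_setD1 a) //= eq_out ?setD11 //.
by rewrite /delete eqxx.
Qed.

(** Two violating sets [U] and [W], for [x] and for [y], would contradict Hall's
    condition by submodularity.  The neighbourhoods
    [X = (N a :\ x) :|: N(U)] and [Y = (N a :\ y) :|: N(W)] satisfy
    [N(a |: U :|: W) \subset X :|: Y], because [x] and [y] differ, and
    [N(U :&: W) \subset X :&: Y], so that
    [#|X| + #|Y|] is at least [#|U| + #|W| + 1]; the extra 1 counts [a], which
    lies neither in [U] nor in [W]. *)
Lemma hall_delete {I T : finType} (N : I -> {set T}) a x y :
    hall_condition N -> x != y ->
  hall_condition (delete N a x) || hall_condition (delete N a y).
Proof.
move=> hallN xy; apply/norP => -[].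
move=> /(delete_violation _ _ _ hallN) [U aNU leX].
move=> /(delete_violation _ _ _ hallN) [W aNW leY].
move/forallP: hallN => hallN.
set X := _ :|: _ in leX; set Y := _ :|: _ in leY.
have leU : #|U :|: W|.+1 <= #|X :|: Y|.
  have -> : #|U :|: W|.+1 = #|a |: (U :|: W)|.
    by rewrite cardsU1 inE negb_or aNU aNW.
  apply: leq_trans (hallN _) (subset_leq_card _).
  apply/bigcupsP => i; rewrite !inE => /or3P [/eqP->|iU|iW].
  - apply/subsetP => z zN; rewrite !inE zN !andbT.
    by case: (eqVneq z x) => [->|//]; rewrite xy !orbT.
  - apply: subset_trans (bigcup_sup i iU) _.
    by rewrite /X -setUA setUCA subsetUl.
  - apply: subset_trans (bigcup_sup i iW) _.
    by rewrite /Y setUA subsetUr.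
have leI : #|U :&: W| <= #|X :&: Y|.
  apply: leq_trans (hallN _) (subset_leq_card _).
  apply/bigcupsP => i; rewrite inE => /andP [iU iW]; rewrite subsetI.
  by rewrite !(subset_trans (bigcup_sup i _) (subsetUr _ _)).
have := leq_trans (leq_add leU leI) (eq_leq (cardsUI X Y)).
move=> /leq_trans /(_ (leq_add leX leY)).
by rewrite addSn cardsUI ltnn.
Qed.

Lemma hall_small {I T : finType} (N : I -> {set T}) :
    hall_condition N -> (forall i, #|N i| <= 1) ->
  exists2 f : I -> T, injective f & forall i, f i \in N i.
Proof.
move=> /forallP hallN small.
have /fin_all_exists [f fN] i : exists x, N i = [set x].
  apply/cards1P; rewrite eqn_leq small /=.
  by have := hallN [set i]; rewrite big_set1 cards1.
exists f => [i j fij|i]; last by rewrite fN set11.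
apply/eqP; apply: contraT => ij.
have := hallN [set i; j].
by rewrite cards2 ij bigcup_setU !big_set1 !fN fij setUid cards1.
Qed.

(** Deletions terminate since each of them decreases the sum of the
    cardinalities of the members of the family. *)
Theorem hall_marriage {I T : finType} (N : I -> {set T}) :
    hall_condition N ->
  exists2 f : I -> T, injective f & forall i, f i \in N i.
Proof.
have [n] := ubnP (\sum_i #|N i|); elim: n N => // n IHn N ltNn hallN.
have [/forallP small|/forallPn [a]] := boolP [forall i, #|N i| <= 1].
  exact: hall_small.
rewrite -ltnNge => /card_gt1P [x [y [xN yN xy]]].
have step z : z \in N a -> hall_condition (delete N a z) ->
    exists2 f : I -> T, injective f & forall i, f i \in N i.
  move=> zN /IHn [|f f_inj fN].
    rewrite -ltnS; apply: leq_trans ltNn; rewrite ltnS [X in _ < X](bigD1 a) //= (bigD1 a) //=.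
    rewrite -addSn leq_add ?leq_sum //.
      by rewrite /delete eqxx [X in _ < X](cardsD1 z) zN.
    by move=> i _; rewrite subset_leq_card ?delete_sub.
  by exists f => // i; apply: (subsetP (delete_sub N a z i)).
by have /orP [/(step x xN)|/(step y yN)] := hall_delete _ a _ _ hallN xy.
Qed.

Definition edges_at {V : finType} (adj : rel V) (v : V) : {set {set V}} :=
  [set E in edges adj | v \in E].

Lemma incident_edgesE {V : finType} (adj : rel V) (U : {set V}) :
  incident_edges adj U = \bigcup_(u in U) edges_at adj u.
Proof.
apply/setP => E; rewrite inE; apply/andP/bigcupP.
  by move=> [Eadj /exists_inP [u uU uE]]; exists u; rewrite // inE Eadj.
move=> [u uU]; rewrite inE => /andP [-> uE]; split=> //.
by apply/exists_inP; exists u.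
Qed.

Lemma edges_atP {V : finType} (adj : rel V) (v : V) (E : {set V}) :
    symmetric adj ->
  reflect (exists w, adj v w /\ E = [set v; w]) (E \in edges_at adj v).
Proof.
move=> adj_sym; rewrite inE; apply: (iffP andP) => [[]|[w [vw ->]]].
  move=> /imset2P [a b _]; rewrite inE => /andP [_ ab] ->.
  rewrite !inE => /orP [] /eqP ->; first by exists b.
  by exists a; rewrite adj_sym setUC.
by rewrite set21; split=> //; apply/imset2P; exists v w; rewrite ?inE.
Qed.

Lemma carried_edge_inj {V : finType} (f : V -> V) :
  (forall v, f (f v) <> v) -> injective (fun v => [set v; f v]).
Proof.
move=> ffN u v uv.
have := set21 u (f u); rewrite uv => /set2P [//|u_fv].
have := set21 v (f v); rewrite -uv => /set2P [//|v_fu].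
by case: (ffN v); rewrite -u_fv -v_fu.
Qed.

Theorem theorem3p5p1 (V : finType) (adj : rel V)
    (adj_sym : symmetric adj) (adj_irr : irreflexive adj) :
  carries_function adj <->
  (forall U : {set V}, #|U| <= #|incident_edges adj U|).
Proof.
split=> [[f [f_adj ffN]] U|hallG].
  rewrite -(card_imset (mem U) (carried_edge_inj f ffN)) incident_edgesE.
  apply/subset_leq_card/subsetP => _ /imsetP [u uU ->].
  by apply/bigcupP; exists u => //; apply/edges_atP => //; exists (f u).
have [|e e_inj eP] := hall_marriage (edges_at adj).
  by apply/forallP => U; rewrite -incident_edgesE.
have /fin_all_exists [f fP] v : exists w, adj v w /\ e v = [set v; w].
  exact/edges_atP.
exists f; split=> [v|v ffv]; first by case: (fP v).
(* The edges chosen at [v] and at [f v] would both be [{v, f v}]. *)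
have fv : f v = v.
  by apply: e_inj; rewrite (fP (f v)).2 ffv setUC -(fP v).2.
by have := (fP v).1; rewrite fv adj_irr.
Qed.
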